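(* Let $X$ be a Banach space. If $T:X\rightrightarrows X^*$ is a maximal monotone multifunction and its domain $D_T$ is either closed and convex or has non-empty interior, then $T$ is regular.
   Context: $X$ is a (real) Banach space with topological dual $X^*$ and $\langle x^*,x\rangle=\langle x,x^*\rangle$ denotes the evaluation pairing. For a multifunction $T:X\rightrightarrows X^*$, its graph is $G(T)=\{(x,x^* )\in X\times X^*: x^*\in T(x)\}$ and its domain is $D_T=\{x\in X: T(x)\neq\emptyset\}$. $T$ is monotone if $\langle x^*-y^*,x-y\rangle\ge 0$ for all $(x,x^* ),(y,y^* )\in G(T)$; it is maximal monotone if it is monotone and there is no monotone multifunction $S:X\rightrightarrows X^*$ whose graph strictly contains $G(T)$. For $(x,x^* )\in X\times X^*$ put $$L(x,x^*,T)=\max\left\{0,\ \sup\left\{\frac{\langle x^*-y^*,y-x\rangle}{\|x-y\|}: (y,y^* )\in G(T),\ y\neq x\right\}\right\}\in[0,\infty],$$ and $d(x^*,T(x))=\inf\{\|y^*-x^*\|: y^*\in T(x)\}$, with $d(x^*,\emptyset)=\infty$. A maximal monotone multifunction $T$ is called regular if $L(x,x^*,T)=d(x^*,T(x))$ for every $(x,x^* )\in X\times X^*$. *)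

(* Defs.v *)
(* MathComp-Analysis; X is a complete normed module over an abstract realType. *)
From HB Require Import structures.
From mathcomp Require Import all_boot all_order all_algebra.
From mathcomp Require Import all_classical all_reals all_analysis.
Import Order.TTheory GRing.Theory Num.Theory.
Import numFieldNormedType.Exports.

Set Implicit Arguments.
Unset Strict Implicit.
Unset Printing Implicit Defensive.

Local Open Scope classical_set_scope.
Local Open Scope ring_scope.

Section dual_space.
Context {R : realType} (X : normedModType R).

Definition continuous_linear_form : {pred X -> R^o} :=
  fun f => `[< linear f /\ continuous f >].

Lemma continuous_linear_form_submod_closed :
  submod_closed continuous_linear_form.
Proof.
split.
  apply/asboolP; split; last exact: cst_continuous.
  by move=> a x y; rewrite /= scaler0 addr0.
move=> a f g /asboolP[lf cf] /asboolP[lg cg]; apply/asboolP; split.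
  by move=> b x y; rewrite !fctE lf lg !scalerDr !scalerA mulrC addrACA.
move=> x; apply: (@continuousD _ _ _ (a \*: f) g); last exact: cg.
by apply: continuousZr; exact: cf.
Qed.

HB.instance Definition _ := GRing.isSubmodClosed.Build R (X -> R^o)
  continuous_linear_form continuous_linear_form_submod_closed.

(* The topological dual of X, with pointwise operations; the coercion makes
   f x the evaluation pairing. *)
Record dual := Dual {
  dual_fun :> X -> R^o ;
  _ : dual_fun \in continuous_linear_form }.

HB.instance Definition _ := [isSub for dual_fun].
HB.instance Definition _ := [Choice of dual by <:].
HB.instance Definition _ := [SubChoice_isSubLmodule of dual by <:].

(* Extended-real valued so that the supremum needs no boundedness side
   condition. *)
Definition dual_norm (f : dual) : \bar R :=
  ereal_sup [set `|f x|%:E | x in [set x : X | `|x| <= 1]].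

End dual_space.

Section multifunctions.
Context {R : realType} {X : normedModType R}.
Implicit Type T : X -> set (dual X).

Definition graph T : set (X * dual X) := [set p | T p.1 p.2].

Definition domain T : set X := [set x | T x !=set0].

Definition monotone_multi T : Prop :=
  forall p q, graph T p -> graph T q -> 0 <= (p.2 - q.2) (p.1 - q.1).

Definition maximal_monotone T : Prop :=
  monotone_multi T /\
  ~ exists S : X -> set (dual X), monotone_multi S /\ graph T `<` graph S.

Definition gapL (x : X) (f : dual X) T : \bar R :=
  maxe 0%E (ereal_sup
    [set ((f - q.2) (q.1 - x) / `|x - q.1|)%:E
      | q in [set q | graph T q /\ q.1 != x]]).

(* ereal_inf set0 = +oo gives d(f, set0) = +oo. *)
Definition dual_dist (f : dual X) (A : set (dual X)) : \bar R :=
  ereal_inf [set dual_norm (g - f) | g in A].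

Definition regular T : Prop :=
  maximal_monotone T /\ forall x f, gapL x f T = dual_dist f (T x).

End multifunctions.

(* Main.v *)
(* Translate so that (x, x^* ) = (0, 0) and suppose <y^*, y> >= - K |y| on the
   graph of T; an element of T(0) of norm at most K is sought.  By Hahn-Banach,
   some z of norm at most K satisfies <z, y> <= <y^*, y> on the graph, and hence
   z \in T(0) by maximality, as soon as a + K |y| >= 0 for every convex
   combination (y, y^*, a) of triples (y_i, y_i^*, <y_i^*, y_i>).  Monotonicity
   against w^* \in T(s y) gives a >= s <y^*, y> - (1 - s) K |y|, and s -> 0
   concludes whenever s y lies in the domain for small s > 0; perturbing y
   towards an interior point makes this work as soon as the domain D
   accumulates at 0 along a ray from that interior point, because the interior
   of the convex hull of D is contained in D.
   Otherwise D has a point w at which some z normal to D satisfies <z, w> < 0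
   (an Ekeland point of the norm if D is closed and convex; the last point of
   the closure of the convex hull on the segment from an interior point to 0 if
   D has interior).  Then T(w) + t z is contained in T(w) for all t >= 0, which
   contradicts the lower bound <y^*, w> >= - K |w|. *)
Require Import Defs.
From HB Require Import structures.
From mathcomp Require Import all_boot all_order all_algebra.
From mathcomp Require Import all_classical all_reals all_analysis.
From mathcomp Require Import ring lra.
Import Order.TTheory GRing.Theory Num.Theory.
Import numFieldNormedType.Exports.
Set Implicit Arguments.
Unset Strict Implicit.
Unset Printing Implicit Defensive.

Local Open Scope classical_set_scope.
Local Open Scope ring_scope.

(* [/=] would otherwise unfold [(f - g) x] into a subtraction of functions. *)
Local Arguments dual_fun : simpl never.

(** * The Hahn-Banach theorem with constraints on a convex cone *)

Section hahn_banach.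
Context {R : realType} {V : lmodType R}.
Implicit Types p q N : V -> R.

Definition sublinear p :=
  (forall x y, p (x + y) <= p x + p y) /\
  (forall t x, 0 < t -> p (t *: x) <= t * p x).

Lemma sublinear0 p : sublinear p -> p 0 = 0.
Proof.
move=> [_ pZ]; have := pZ 2%:R 0; have := pZ (2%:R^-1) 0.
rewrite !scaler0 ltr0n invr_gt0 ltr0n => /(_ isT) h1 /(_ isT) h2.
by lra.
Qed.

Lemma sublinearZ p t x : sublinear p -> 0 <= t -> p (t *: x) = t * p x.
Proof.
move=> sp; rewrite le_eqVlt => /predU1P[<-|t0].
  by rewrite scale0r mul0r sublinear0.
apply/le_anti; rewrite sp.2//= -ler_pdivlMl//.
by rewrite -{1}[x](scalerK (lt0r_neq0 t0)) sp.2// invr_gt0.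
Qed.

Lemma sublinear_opp_le p x : sublinear p -> - p (- x) <= p x.
Proof.
move=> sp; have := sp.1 x (- x).
by rewrite subrr sublinear0//; lra.
Qed.

(* The sublinear functional [x |-> inf_(y, a) N (x + y) + a]. *)
Lemma sublinear_inf_cone N (A : set (V * R^o)) : sublinear N ->
  A 0 -> (forall c d, A c -> A d -> A (c + d)) ->
  (forall (t : R) c, 0 < t -> A c -> A (t *: c)) ->
  (forall c, A c -> 0 <= N c.1 + c.2) ->
  exists q, [/\ sublinear q, forall x, q x <= N x &
    forall c, A c -> q (- c.1) <= c.2].
Proof.
move=> sN A0 AD AZ AN.
pose S x := [set N (x + c.1) + c.2 | c in A]; pose q x := inf (S x).
have S0 x : S x !=set0 by exists (N (x + 0) + 0); exists 0.
have lbS x : has_lbound (S x).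
  exists (- N (- x)) => _ [c /AN cN <-].
  have := sN.1 (- x) (x + c.1); rewrite addKr; lra.
have qle x c : A c -> q x <= N (x + c.1) + c.2.
  by move=> Ac; apply: ge_inf => //; exists c.
have qN x : q x <= N x by rewrite (le_trans (qle x _ A0))//= !addr0.
exists q; split => //; last first.
  by move=> c Ac; rewrite (le_trans (qle _ _ Ac))// addNr sublinear0// add0r.
split=> [x y|t x t0].
  rewrite -lerBlDr; apply: lb_le_inf => // _ [c Ac <-].
  rewrite lerBlDr -lerBlDl; apply: lb_le_inf => // _ [d Ad <-].
  have := qle (x + y) _ (AD _ _ Ac Ad); rewrite /= addrACA => h.
  by have := sN.1 (x + c.1) (y + d.1); lra.
rewrite -ler_pdivrMl//; apply: lb_le_inf => // _ [c Ac <-].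
rewrite ler_pdivrMl// (le_trans (qle _ _ (AZ _ _ t0 Ac)))//=.
by rewrite -scalerDr (sublinearZ _ sN (ltW t0)) mulrDr.
Qed.

(** Zorn's lemma for the reversed pointwise order. The infimum of a chain is finite because
    [p x >= - p (- x) >= - N (- x)], and subadditive because two members of a chain can be replaced
    by the smaller one. *)
Lemma sublinear_minimal N : sublinear N -> exists p,
  [/\ sublinear p, forall x, p x <= N x &
    forall q, sublinear q -> (forall x, q x <= p x) -> q = p].
Proof.
move=> sN.
pose T := {p : V -> R | sublinear p /\ forall x, p x <= N x}.
pose rT (p q : T) := `[< forall x, sval q x <= sval p x >].
have [| | | |[p [sp pN]] pmin] := @Zorn T rT.
- by move=> p; apply/asboolP.
- by move=> p q r /asboolP h /asboolP k; apply/asboolP => x; exact: le_trans (h x).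
- move=> [p hp] [q hq] /asboolP /= h /asboolP /= k; apply: eq_exist.
  by apply/funext => x; apply/le_anti; rewrite h k.
- move=> F tF; have [->|/set0P[p0 Fp0]] := eqVneq F set0.
    by exists (exist _ N (conj sN (fun x => lexx (N x)))).
  pose S x := [set sval p x | p in F]; pose q x := inf (S x).
  have S0 x : S x !=set0 by exists (sval p0 x); exists p0.
  have lbS x : has_lbound (S x).
    exists (- N (- x)) => _ [[p [sp pN]] _ <-] /=.
    by apply: le_trans (sublinear_opp_le _ sp); rewrite lerN2.
  have qle x (p : T) : F p -> q x <= sval p x.
    by move=> Fp; apply: ge_inf => //; exists p.
  have sq : sublinear q.
    split=> [x y|t x t0].
      rewrite -lerBlDr; apply: lb_le_inf => // _ [p Fp <-].
      rewrite lerBlDr -lerBlDl; apply: lb_le_inf => // _ [p' Fp' <-].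
      rewrite lerBlDl; case: (tF _ _ Fp Fp') => /asboolP pp'.
        have := qle (x + y) _ Fp'; have := (svalP p').1.1 x y.
        by have := pp' x; lra.
      have := qle (x + y) _ Fp; have := (svalP p).1.1 x y.
      by have := pp' y; lra.
    rewrite -ler_pdivrMl//; apply: lb_le_inf => // _ [p Fp <-].
    by rewrite ler_pdivrMl// (le_trans (qle _ _ Fp))// (svalP p).1.2.
  have qN x : q x <= N x by rewrite (le_trans (qle _ _ Fp0))// (svalP p0).2.
  exists (exist _ q (conj sq qN)) => p Fp; apply/asboolP => x; exact: qle.
exists p; split=> // q sq qp.
have qN x : q x <= N x by exact: le_trans (qp x) (pN x).
by have /(_ _)/(congr1 sval) := pmin (exist _ q (conj sq qN)); apply; apply/asboolP.
Qed.

(** By minimality [p] equals the functional [inf_(t >= 0) p (x + t y) - t p y] below it, hence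
    [p (- y) <= - p y], and subadditivity becomes additivity. *)
Lemma sublinear_minimal_linear p : sublinear p ->
  (forall q, sublinear q -> (forall x, q x <= p x) -> q = p) ->
  linear (p : V -> R^o).
Proof.
move=> sp pmin.
have pD x y : p (x + y) = p x + p y.
  apply/le_anti; rewrite sp.1/=.
  pose A : set (V * R^o) := [set c | exists2 t, 0 <= t & c = (t *: y, - (t * p y))].
  have [||||q [sq qp qA]] := sublinear_inf_cone (A := A) sp.
  - by exists 0; rewrite // scale0r mul0r oppr0.
  - move=> _ _ [s s0 ->] [t t0 ->]; exists (s + t); first exact: addr_ge0.
    by congr pair; rewrite /= ?scalerDl// mulrDl opprD.
  - move=> t _ t0 [s s0 ->]; exists (t * s); first by rewrite mulr_ge0// ltW.
    by congr pair => /=; [rewrite scalerA | rewrite scalerN -mulrA].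
  - by move=> _ [t t0 ->] /=; rewrite sublinearZ// subrr.
  have {}qA : q (- y) <= - p y.
    by apply: (qA (y, - p y)); exists 1; rewrite ?scale1r ?mul1r.
  rewrite (pmin _ sq qp) in qA.
  by have := sp.1 (x + y) (- y); rewrite addrK; lra.
have pN x : p (- x) = - p x.
  by apply/eqP; rewrite -addr_eq0 -pD addNr sublinear0.
move=> a x y; rewrite pD; congr (_ + _).
have [a0|a0] := leP 0 a; first by rewrite sublinearZ.
by rewrite -[a]opprK scaleNr pN sublinearZ ?oppr_ge0 1?ltW// scaleNr.
Qed.

(** The constraints from [A] are absorbed into the sublinear functional of [sublinear_inf_cone]; a
    minimal sublinear functional below it is linear and meets them. *)
Theorem hahn_banach_cone N (A : set (V * R^o)) : sublinear N ->
  A 0 -> (forall c d, A c -> A d -> A (c + d)) ->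
  (forall (t : R) c, 0 < t -> A c -> A (t *: c)) ->
  (forall c, A c -> 0 <= N c.1 + c.2) ->
  exists f : V -> R^o, [/\ linear f, forall x, f x <= N x &
    forall c, A c -> - c.2 <= f c.1].
Proof.
move=> sN A0 AD AZ AN.
have [q [sq qN qA]] := sublinear_inf_cone sN A0 AD AZ AN.
have [p [sp pq pmin]] := sublinear_minimal sq.
have lp := sublinear_minimal_linear sp pmin.
exists p; split => // [x|c Ac]; first exact: le_trans (qN x).
rewrite lerNl -[c.1]opprK; apply: le_trans (qA _ Ac); apply: le_trans (pq _).
by have := sublinear_opp_le (- c.1) sp; rewrite opprK; lra.
Qed.

End hahn_banach.

(** * Convex sets and continuous linear forms *)

Lemma convex_setP {R : numDomainType} {V : lmodType R} (A : set V) :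
  convex_set A <-> forall s t x y, 0 <= s -> 0 <= t -> s + t = 1 ->
    A x -> A y -> A (s *: x + t *: y).
Proof.
split=> [cA s t x y s0 t0 st1 Ax Ay|cA x y k xA yA].
  have s1 : s <= 1 by rewrite -st1 lerDl.
  have := cA x y (Itv01 s0 s1); rewrite !inE => /(_ Ax Ay).
  by have -> : t = 1 - s by rewrite -st1 addrAC subrr add0r.
move: xA yA; rewrite !inE => xA yA; apply: cA => //.
- by rewrite subr_ge0.
- by rewrite addrC subrK.
Qed.

Section dual_theory.
Context {R : realType} {X : normedModType R}.
Implicit Types (f g z : dual X) (x y : X).

Lemma dual_linear f : linear f.
Proof. by case: f => f fP; have /asboolP[] := fP. Qed.

Lemma dualD f x y : f (x + y) = f x + f y.
Proof. by have := dual_linear f 1 x y; rewrite !scale1r. Qed.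

Lemma dual0 f : f 0 = 0.
Proof. by apply: (addrI (f 0)); rewrite -dualD !addr0. Qed.

Lemma dualZ f (t : R) x : f (t *: x) = t * f x.
Proof. by have := dual_linear f t x 0; rewrite dual0 !addr0. Qed.

Lemma dualN f x : f (- x) = - f x.
Proof. by rewrite -scaleN1r dualZ mulN1r. Qed.

Lemma dualB f x y : f (x - y) = f x - f y.
Proof. by rewrite dualD dualN. Qed.

Lemma dual_bounded f : exists2 K, 0 <= K & forall x, `|f x| <= K * `|x|.
Proof.
have [Lf cf] : linear f /\ continuous f by case: f => f fP; have /asboolP[] := fP.
pose F : {linear X -> R^o} :=
  HB.pack (dual_fun f) (GRing.isLinear.Build _ _ _ _ _ Lf).
have /linear_boundedP[M [_ MF]] := @continuous_linear_bounded _ _ _ 0 F (cf 0).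
exists (`|M| + 1); first by rewrite addr_ge0.
by apply: MF; rewrite (le_lt_trans (ler_norm M))// ltrDl.
Qed.

Lemma dual_of_linear (h : X -> R^o) K : linear h ->
  (forall x, `|h x| <= K * `|x|) -> exists f, forall x, f x = h x.
Proof.
move=> Lh hK.
pose F : {linear X -> R^o} := HB.pack h (GRing.isLinear.Build _ _ _ _ _ Lh).
have ch : continuous h.
  apply: (@bounded_linear_continuous _ _ _ F); apply/linear_boundedP.
  exists K; split; first exact: num_real.
  by move=> M KM x; rewrite (le_trans (hK x))// ler_wpM2r// ltW.
have hP : h \in @continuous_linear_form R X by apply/asboolP.
by exists (Dual hP).
Qed.

Lemma dual_combE (s t : R) f g x : (s *: f + t *: g) x = s * f x + t * g x.
Proof. by []. Qed.

Lemma dual_subE f g x : (f - g) x = f x - g x.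
Proof. by []. Qed.

(** Hahn-Banach on the cone generated by [A] gives [f] with [- c.2 <= f c.1]; [z] is its opposite,
    continuous because [f x <= K |x|]. *)
Lemma dual_sandwich (A : set (X * R^o)) (K : R) : 0 <= K -> convex_set A ->
  (forall c, A c -> 0 <= c.2 + K * `|c.1|) ->
  exists2 z : dual X, forall x, `|z x| <= K * `|x| & forall c, A c -> z c.1 <= c.2.
Proof.
move=> K0 /convex_setP cA AK; pose N x := K * `|x|.
have sN : sublinear N.
  split=> [x y|t x t0]; first by rewrite /N -mulrDr ler_wpM2l// ler_normD.
  by rewrite /N normrZ gtr0_norm// mulrCA.
pose B : set (X * R^o) :=
  [set d | d = 0 \/ exists t c, [/\ 0 < t, A c & d = t *: c]].
have [||||f [Lf fN fB]] := hahn_banach_cone (A := B) sN.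
- by left.
- move=> _ d [->|[s [c [s0 Ac ->]]]]; first by rewrite add0r.
  case=> [->|[t [e [t0 Ae ->]]]].
    by rewrite addr0; right; exists s, c.
  right; exists (s + t), ((s / (s + t)) *: c + (t / (s + t)) *: e).
  have st0 : 0 < s + t by rewrite addr_gt0.
  split => //.
    apply: cA => //; rewrite ?divr_ge0 ?ltW//.
    by rewrite -mulrDl divff// gt_eqF.
  by rewrite scalerDr !scalerA ![(s + t) * _]mulrC !divfK// gt_eqF.
- move=> t _ t0 [->|[s [c [s0 Ac ->]]]]; first by left; rewrite scaler0.
  by right; exists (t * s), c; rewrite mulr_gt0// scalerA.
- move=> _ [->|[t [c [t0 Ac ->]]]] /=; first by rewrite /N normr0 mulr0 addr0.
  rewrite /N normrZ gtr0_norm// mulrCA -mulrDr; apply: mulr_ge0; first exact: ltW.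
  by rewrite addrC; exact: AK.
have [z zE] : exists z : dual X, forall x, z x = f x.
  apply: (dual_of_linear (K := K)) => // x; rewrite ler_norml fN andbT.
  have f0 : f 0 = 0.
    by apply: (addrI (f 0)); have := Lf 1 0 0; rewrite !scale1r !addr0.
  have := fN (- x); have := Lf (-1) x 0.
  by rewrite /N normrN f0 !addr0 !scaleN1r => ->; rewrite lerNl.
exists (- z) => [x|c Ac].
  have -> : (- z) x = z (- x) by rewrite dualN.
  have h1 := fN x; have h2 := fN (- x); rewrite -!zE /N normrN in h1 h2.
  by rewrite ler_norml h2 dualN lerN2 h1.
have -> : (- z) c.1 = - f c.1 by rewrite -zE.
by rewrite lerNl; apply: fB; right; exists 1, c; rewrite scale1r.
Qed.

End dual_theory.

(** Banach-Steinhaus: upper bounds at [x] and at [- x] together bound [|z x|]. *)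
Lemma dual_uniform_bounded {R : realType} {X : completeNormedModType R}
    (F : set (dual X)) :
  (forall x, exists M, forall z, F z -> z x <= M) ->
  exists2 K, 0 <= K & forall z, F z -> forall x, `|z x| <= K * `|x|.
Proof.
move=> FM.
have [f [z Fz <-]|x|M FuM] :=
    @Banach_Steinhauss R X R^o [set dual_fun z | z in F] _ _ 1.
- split; last exact: dual_linear.
  have [K K0 zK] := dual_bounded z.
  by move=> r; exists (K * r) => x xr; rewrite (le_trans (zK x))// ler_wpM2l.
- have [M hM] := FM x; have [M' hM'] := FM (- x).
  exists (Num.max M M') => _ [z Fz <-].
  rewrite ler_norml le_max hM//= lerNl le_max -dualN hM'//.
  by rewrite orbT.
exists `|M| => // z Fz x; have [->|x0] := eqVneq x 0.
  by rewrite dual0 !normr0 mulr0.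
have xp : 0 < `|x| by rewrite normr_gt0.
have : `|z (`|x|^-1 *: x)| <= M.
  apply: FuM; first by exists z.
  by rewrite normrZ normfV normr_id mulVf// gt_eqF.
rewrite dualZ normrM normfV normr_id ler_pdivrMl// mulrC => /le_trans; apply.
by rewrite ler_wpM2r// ler_norm.
Qed.

(** Generated by binary combinations, so that facts about the hull follow by induction. *)
Inductive convex_hull {R : numDomainType} {V : lmodType R} (A : set V) : set V :=
| convex_hull_sub x : A x -> convex_hull A x
| convex_hull_comb s t x y : 0 <= s -> 0 <= t -> s + t = 1 ->
    convex_hull A x -> convex_hull A y -> convex_hull A (s *: x + t *: y).

Lemma convex_hull_convex {R : numDomainType} {V : lmodType R} (A : set V) :
  convex_set (convex_hull A).
Proof. by apply/convex_setP => *; exact: convex_hull_comb. Qed.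

Lemma convex_hull_min {R : numDomainType} {V : lmodType R} (A C : set V) :
  convex_set C -> A `<=` C -> convex_hull A `<=` C.
Proof. by move=> /convex_setP cC subAC x; elim=> *; [exact: subAC|exact: cC]. Qed.

(** * Monotone multifunctions and the convex hull of the lifted graph *)

Section monotone.
Context {R : realType} {X : normedModType R}.
Implicit Types (T P : X -> set (dual X)) (f g z : dual X) (x y : X).

(** A point monotonically related to the whole graph could be added to it; conversely, every point
    of a monotone extension is so related. *)
Lemma maximal_monotoneP T : maximal_monotone T <->
  forall x z, T x z <-> forall y g, T y g -> 0 <= (g - z) (y - x).
Proof.
split=> [[mT maxT] x z|TP].
  split=> [Txz y g Tyg|xzP]; first exact: (mT (y, g) (x, z)).
  apply: contrapT => nT; apply: maxT.
  exists (fun y => [set g | T y g \/ (y = x /\ g = z)]); split; last first.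
    split=> [[y g] /= Tyg|]; first by left.
    by move=> /(_ (x, z)); rewrite /graph/= => h; apply: nT; apply: h; right.
  move=> [y g] [y' g'] [/= Tyg|[/= -> ->]] [/= Tyg'|[/= -> ->]].
  - exact: (mT (y, g) (y', g')).
  - exact: xzP.
  - by have := xzP _ _ Tyg'; rewrite /= !dual_subE !dualB; lra.
  - by rewrite !subrr dual0.
split=> [[y g] [x z] /= Tyg /(TP x z)|[S [mS [TS nST]]]]; first exact.
apply: nST => -[x z] Sxz; apply/TP => y g Tyg.
by apply: (mS (y, g) (x, z)) => //; exact: TS.
Qed.

(** The pairing is not affine; carried as a third coordinate, it becomes on the convex hull the
    weighted mean of the pairings. *)
Definition lifted_graph T : set (X * dual X * R^o) :=
  [set c | T c.1.1 c.1.2 /\ c.2 = c.1.2 c.1.1].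

Local Notation hull T := (convex_hull (lifted_graph T)).

Lemma hull_graph T y g : T y g -> hull T (y, g, g y).
Proof. by move=> Tyg; exact: convex_hull_sub. Qed.

Lemma hull_domain T x : convex_hull (domain T) x -> exists g a, hull T (x, g, a).
Proof.
elim=> [y [g Tyg]|s t y y' s0 t0 st _ [g [a h]] _ [g' [a' h']]].
  by exists g, (g y); exact: hull_graph.
exists (s *: g + t *: g'), (s * a + t * a').
exact: (convex_hull_comb s0 t0 st h h').
Qed.

Lemma domain_hull T c : hull T c -> convex_hull (domain T) c.1.1.
Proof.
elim=> [d [Td _]|s t d d' s0 t0 st _ h _ h'].
  by apply: convex_hull_sub; exists d.1.2.
exact: (convex_hull_comb s0 t0 st h h').
Qed.

(** Once expanded, monotonicity against [(w, g)] is affine in the triple [c], so it passes to convex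
    combinations. *)
Lemma hull_monotone T c w g : monotone_multi T -> hull T c -> T w g ->
  0 <= c.2 + g w - c.1.2 w - g c.1.1.
Proof.
move=> mT + Twg; elim=> [d [Td ->]|s t d d' s0 t0 st _ h _ h'].
  have := mT (d.1.1, d.1.2) (w, g) Td Twg.
  by rewrite /= dual_subE !dualB; lra.
rewrite /= dual_combE dualD !dualZ.
have := mulr_ge0 s0 h; have := mulr_ge0 t0 h'.
have -> : s = 1 - t by rewrite -st addrK.
rewrite /GRing.scale /=; lra.
Qed.

Lemma hull_monotone2 T c d : monotone_multi T -> hull T c -> hull T d ->
  0 <= c.2 + d.2 - c.1.2 d.1.1 - d.1.2 c.1.1.
Proof.
move=> mT hc; elim=> [e [Te ->]|s t e e' s0 t0 st _ h _ h'].
  exact: (hull_monotone mT hc Te).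
rewrite /= dual_combE dualD !dualZ.
have := mulr_ge0 s0 h; have := mulr_ge0 t0 h'.
have -> : s = 1 - t by rewrite -st addrK.
rewrite /GRing.scale /=; lra.
Qed.

Lemma hull_ge T c : monotone_multi T -> hull T c -> c.1.2 c.1.1 <= c.2.
Proof. by move=> mT hc; have := hull_monotone2 mT hc hc; lra. Qed.

(** The map [c |-> (c.1.1 - x, c.2 - c.1.2 x)] is affine, so the image of the hull is convex.
    [dual_sandwich] then gives [z (y - x) <= g (y - x)] on the graph. *)
Lemma hull_extension P x (K : R) : 0 <= K ->
  (forall c, hull P c -> 0 <= c.2 - c.1.2 x + K * `|c.1.1 - x|) ->
  exists2 z : dual X, forall u, `|z u| <= K * `|u| &
    forall y g, P y g -> 0 <= (g - z) (y - x).
Proof.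
move=> K0 PK.
pose A : set (X * R^o) := [set (c.1.1 - x, c.2 - c.1.2 x) | c in hull P].
have cA : convex_set A.
  apply/convex_setP => s t _ _ s0 t0 st [c hc <-] [d hd <-].
  exists (s *: c + t *: d); first exact: convex_hull_comb.
  congr pair => /=.
    by rewrite !scalerBr addrACA -opprD -scalerDl st scale1r.
  by rewrite dual_combE !scalerBr addrACA opprD.
have [_ [c hc <-]|z zK zA] := dual_sandwich K0 cA; first exact: PK.
exists z => // y g Pyg; have := zA _ (imageP _ (hull_graph Pyg)).
by rewrite /= dual_subE dualB; lra.
Qed.

Lemma maximal_hull_extension T x (K : R) : maximal_monotone T -> 0 <= K ->
  (forall c, hull T c -> 0 <= c.2 - c.1.2 x + K * `|c.1.1 - x|) ->
  exists2 z : dual X, T x z & forall u, `|z u| <= K * `|u|.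
Proof.
move=> mT K0 TK; have [z zK zT] := hull_extension K0 TK.
by exists z => //; apply/(maximal_monotoneP T).1.
Qed.

End monotone.

Lemma affine_ge0 {R : realFieldType} (b c : R) :
  (forall s, 0 < s -> s < 1 -> 0 <= b + s * c) -> 0 <= b.
Proof.
move=> bc; rewrite leNgt; apply/negP => b0.
have cp := normr_ge0 c; have dp : 0 < `|c| - b by lra.
(* For this [s], [s c <= s |c| < - b / 2], hence [b + s c < b / 2 < 0]. *)
pose s := - b / (2 * (`|c| - b)).
have s0 : 0 < s by rewrite divr_gt0//; lra.
have s1 : s < 1 by rewrite ltr_pdivrMr; lra.
have sE : s * (`|c| - b) = - b / 2.
  by rewrite /s invfM mulrA -mulrA mulVf ?mulr1// gt_eqF.
have := bc s s0 s1; have := ler_wpM2l (ltW s0) (ler_norm c).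
by have := mulr_gt0 s0 s0; nra.
Qed.

(** * Maximal monotone multifunctions on a Banach space *)

Section maximal.
Context {R : realType} {X : completeNormedModType R}.
Variable T : X -> set (dual X).
Hypothesis mT : maximal_monotone T.

Local Notation hull := (convex_hull (lifted_graph T)).
Local Notation hull_dom := (convex_hull (domain T)).

(* The elements of norm at most [n] extend to [w] by some [z n]; each [z n] is
   bounded above on the domain of [T], eventually uniformly in [n], so that the
   uniform boundedness principle applies. *)
Lemma interior_hull_domain w (r : R) : 0 < r ->
  (forall y, `|y - w| < r -> hull_dom y) -> domain T w.
Proof.
move=> r0 wr.
pose P n y : set (dual X) := [set g | T y g /\ forall u, `|g u| <= n%:R * `|u|].
have hullP n c : convex_hull (lifted_graph (P n)) c ->
    hull c /\ forall u, `|c.1.2 u| <= n%:R * `|u|.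
  elim=> [d [[Td dn] dE]|s t d d' s0 t0 st _ [h dn] _ [h' d'n]].
    by split=> //; exact: convex_hull_sub.
  split=> [|u]; first exact: convex_hull_comb.
  rewrite /= dual_combE (le_trans (ler_normD _ _))// !normrM.
  rewrite (ger0_norm s0) (ger0_norm t0).
  have := ler_wpM2l s0 (dn u); have := ler_wpM2l t0 (d'n u).
  have -> : s = 1 - t by rewrite -st addrK.
  lra.
have /choice[z zP] : forall n, exists z : dual X, (forall u, `|z u| <= n%:R * `|u|) /\
    forall y g, P n y g -> 0 <= (g - z) (y - w).
  (* By [hull_ge], [c.2 - c.1.2 w >= c.1.2 (c.1.1 - w) >= - n |c.1.1 - w|]. *)
  move=> n; have [c /hullP[hc cn]|z zn zP] := @hull_extension _ _ (P n) w n%:R (ler0n _ _).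
    have := hull_ge mT.1 hc.
    have := cn (c.1.1 - w); rewrite ler_norml dualB => /andP[h _]; lra.
  by exists z.
(* A point of the hull involves finitely many graph points, all in [P n] for large [n]. *)
have zhull c : hull c ->
    exists N, forall n, (N <= n)%N -> z n (c.1.1 - w) <= c.2 - c.1.2 w.
  elim=> [[[y g] _] [/= Tyg ->]|s t d d' s0 t0 st _ [N h] _ [N' h']].
    have [K K0 gK] := dual_bounded g.
    exists (Num.truncn K).+1 => n Kn.
    have Pg : P n y g.
      split=> // u; rewrite (le_trans (gK u))// ler_wpM2r//.
      by rewrite (le_trans (ltW (truncnS_gt K)))// ler_nat.
    by have := (zP n).2 _ _ Pg; rewrite dual_subE !dualB; lra.
  exists (maxn N N') => n; rewrite geq_max => /andP[/h hn /h' h'n].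
  rewrite /= dual_combE dualB dualD !dualZ.
  have := ler_wpM2l s0 hn; have := ler_wpM2l t0 h'n; rewrite !dualB.
  have -> : s = 1 - t by rewrite -st addrK.
  rewrite /GRing.scale /=; lra.
have [u|K K0 zK] := dual_uniform_bounded (F := range z).
  pose e := r / (2 * (`|u| + 1)).
  have u0 := normr_ge0 u.
  have e0 : 0 < e by rewrite divr_gt0//; lra.
  have [|g [a /zhull[N /= hN]]] := @hull_domain _ _ T (w + e *: u).
    apply: wr; rewrite addrAC subrr add0r normrZ gtr0_norm//.
    by rewrite mulrAC ltr_pdivrMr; nra.
  (* The first bound serves [n >= N], the second the finitely many earlier [z n], of norm at most
     [N]. *)
  exists (Num.max (a - g w) (N%:R * `|e *: u|) / e) => _ [n _ <-].
  rewrite ler_pdivlMr// mulrC -dualZ le_max; apply/orP.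
  have [Nn|nN] := leqP N n.
    by left; have := hN n Nn; rewrite addrAC subrr add0r.
  right; rewrite (le_trans (ler_norm _))// (le_trans ((zP n).1 _))//.
  by rewrite ler_wpM2r// ler_nat ltnW.
have [c hc|g Tg _] := maximal_hull_extension (x := w) mT K0; last by exists g.
have [N /(_ _ (leqnn N)) hN] := zhull _ hc.
have := zK (z N) (imageP _ I) (c.1.1 - w); rewrite ler_norml => /andP[h _]; lra.
Qed.

(* If the cone generated at [w] by [C] avoids a neighbourhood of [- w], then
   [T w] is unbounded in a direction where the hypothesis on [T] fails. *)
Lemma no_outward_normal (K eta : R) w (C : set X) :
  (forall y g, T y g -> - (K * `|y|) <= g y) ->
  domain T w -> convex_set C -> domain T `<=` C -> 0 < eta ->
  ~ forall u c, 0 <= u -> C c -> eta <= `|w + u *: (c - w)|.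
Proof.
move=> TK [g Tg] /convex_setP cC TC eta0 Cw.
(* As the cone stays at distance [eta] from 0, the sandwich with constant 1 yields [z <= - eta] on
   it. *)
pose A : set (X * R^o) :=
  [set d | exists u c, [/\ 0 <= u, C c & d = (w + u *: (c - w), - eta)]].
have cA : convex_set A.
  apply/convex_setP => s t _ _ s0 t0 st [u [c [u0 Cc ->]]] [v [d [v0 Cd ->]]].
  have su0 : 0 <= s * u by rewrite mulr_ge0.
  have tv0 : 0 <= t * v by rewrite mulr_ge0.
  have E2 : s *: (- eta : R^o) + t *: (- eta : R^o) = - eta.
    by rewrite -scalerDl st scale1r.
  have E1 : s *: (w + u *: (c - w)) + t *: (w + v *: (d - w)) =
      w + ((s * u) *: (c - w) + (t * v) *: (d - w)).
    by rewrite !scalerDr addrACA -scalerDl st scale1r !scalerA.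
  have [q0|q0] := eqVneq (s * u + t * v) 0.
    exists 0, c; split => //; congr pair => //=; rewrite E1 scale0r.
    have -> : s * u = 0 by lra.
    have -> : t * v = 0 by lra.
    by rewrite !scale0r addr0.
  pose q := s * u + t * v; exists q, ((s * u / q) *: c + (t * v / q) *: d).
  split; first exact: addr_ge0.
    by apply: cC => //; rewrite ?divr_ge0 ?addr_ge0// -mulrDl divff.
  congr pair => //=; rewrite E1; congr (_ + _).
  rewrite [RHS]scalerBr [X in _ = X - _]scalerDr !scalerA.
  rewrite ![q * _]mulrC !divfK// !scalerBr.
  by rewrite addrACA -opprD -scalerDl.
have [_ [u [c [u0 Cc ->]]]|z _ zA] := dual_sandwich ler01 cA.
  by have := Cw u c u0 Cc; rewrite /=; lra.
have {}zA u c : 0 <= u -> C c -> z w + u * z (c - w) <= - eta.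
  by move=> u0 Cc; rewrite -dualZ -dualD; apply: (zA (_, _)); exists u, c.
have Ww : C w by apply: TC; exists g.
have zw : z w <= - eta by have := zA 0 w (lexx 0) Ww; rewrite mul0r addr0.
have zC c : C c -> z (c - w) <= 0.
  move=> Cc; rewrite leNgt; apply/negP => zc.
  (* Moving by this multiple of [c - w] would bring [z] up to 0. *)
  have q0 : 0 <= - z w / z (c - w) by rewrite divr_ge0// ?ltW//; lra.
  by have := zA _ _ q0 Cc; rewrite divfK ?gt_eqF//; lra.
(* Large enough for [g w + t z w < - K |w|]. *)
pose t := (`|g w + K * `|w| | + 1) / eta.
have t0 : 0 <= t by rewrite divr_ge0 ?addr_ge0// ltW.
have Tw : T w (1 *: g + t *: z).
  apply/(maximal_monotoneP T).1 => // y h Tyh.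
  rewrite dual_subE dual_combE mul1r.
  have := ((maximal_monotoneP T).1 mT w g).1 Tg y h Tyh.
  have Dy : domain T y by exists h.
  have := mulr_ge0_le0 t0 (zC _ (TC _ Dy)).
  by rewrite dual_subE; lra.
have := TK _ _ Tw; rewrite dual_combE mul1r.
have := ler_wpM2l t0 zw; rewrite [t * - eta]mulrN divfK ?gt_eqF//.
by have := ler_norm (g w + K * `|w|); lra.
Qed.

(** Two limits: [s -> 0] along the segment from the perturbed point [e] to 0, by monotonicity
    against [T (s e)], then [d -> 0]. *)
Lemma starshaped_extension (K : R) v : 0 <= K ->
  (forall y g, T y g -> - (K * `|y|) <= g y) -> domain T v ->
  (forall y d s, hull_dom y -> 0 < d -> d < 1 -> 0 < s -> s < 1 ->
    domain T (s *: ((1 - d) *: y + d *: v))) ->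
  exists2 z : dual X, T 0 z & forall u, `|z u| <= K * `|u|.
Proof.
move=> K0 TK [g Tg] Tv; apply: maximal_hull_extension => // c hc.
rewrite dual0 !subr0.
apply: (@affine_ge0 _ _ (g v - c.2 + K * (`|v| - `|c.1.1|))) => d d0 d1.
have d10 : 0 <= 1 - d by lra.
have := convex_hull_comb d10 (ltW d0) (subrK _ _) hc (hull_graph Tg).
set e := _ + _ => he.
have e2 : e.2 = (1 - d) * c.2 + d * g v by [].
have : `|e.1.1| <= (1 - d) * `|c.1.1| + d * `|v|.
  rewrite (le_trans (ler_normD _ _))// !normrZ ger0_norm// gtr0_norm//.
move=> /(ler_wpM2l K0) en.
suff: 0 <= e.2 + K * `|e.1.1| by rewrite e2; lra.
apply: (@affine_ge0 _ _ (- (e.1.2 e.1.1 + K * `|e.1.1|))) => s s0 s1.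
have [h Th] := Tv c.1.1 d s (domain_hull hc) d0 d1 s0 s1.
have := hull_monotone mT.1 he Th; have := TK _ _ Th.
rewrite -[_ *: c.1.1 + _]/e.1.1 !dualZ normrZ gtr0_norm//.
rewrite mulrCA -mulrN ler_pM2l// => h1.
have : 0 <= 1 - s by lra.
move=> /(ler_wpM2l)/(_ _ _ h1); lra.
Qed.

End maximal.

(* Ekeland's variational principle for the norm. *)
Lemma norm_almost_minimal {R : realType} {X : completeNormedModType R}
    (D : set X) : closed D -> D !=set0 ->
  exists2 w, D w & forall c, D c -> `|w| <= `|c| + 2^-1 * `|c - w|.
Proof.
move=> clD [x0 Dx0].
pose S w := [set c | D c /\ `|c| + 2^-1 * `|c - w| <= `|w|].
(* [next w] brings the norm at least halfway down to its infimum over [S w]. *)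
have /choice[next nextP] : forall w, exists c, D w ->
    S w c /\ forall d, S w d -> `|c| <= (`|w| + `|d|) / 2.
  move=> w; have [Dw|nDw] := pselect (D w); last by exists w.
  have Sw : S w w by split; rewrite // subrr normr0 mulr0 addr0.
  pose N := [set `|c| | c in S w].
  have lbN : has_lbound N by exists 0 => _ [c _ <-].
  have hN : has_inf N by split=> //; exists `|w|; exists w.
  have Nle d : S w d -> inf N <= `|d| by move=> Sd; apply: ge_inf => //; exists d.
  have [wN|Nw] := leP `|w| (inf N).
    by exists w => _; split=> // d /Nle; lra.
  have e0 : 0 < (`|w| - inf N) / 2 by lra.
  have [_ [c Sc <-] cN] := inf_adherent e0 hN.
  by exists c => _; split=> // d /Nle; lra.
pose x n := iter n next x0.
have Dx n : D (x n) by elim: n => // n /nextP[[]].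
have Sx n k : S (x n) (x (k + n)%N).
  elim: k => [|k [_ IH]]; first by split; rewrite // subrr normr0 mulr0 addr0.
  have [[Dk h] _] := nextP _ (Dx (k + n)%N); split => //.
  rewrite -[x (k.+1 + n)%N]/(next (x (k + n)%N)).
  have := ler_distD (x (k + n)%N) (next (x (k + n)%N)) (x n); lra.
pose N := range (fun n => `|x n|).
have lbN : has_lbound N by exists 0 => _ [n _ <-].
have hN : has_inf N by split=> //; exists `|x 0%N|; exists 0%N.
(* For [m >= n], [|x m - x n| / 2 <= |x n| - |x m|], and [|x n|] can be taken close to the infimum
   of the norms. *)
have cx : cauchy (x @ \oo).
  apply: cauchy_exP => e e0; have e20 : 0 < e / 2 by lra.
  have [_ [n _ <-] nN] := inf_adherent e20 hN.
  exists (x n); exists n => // m /= nm; rewrite -ball_normE /= distrC.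
  have := (Sx n (m - n)%N).2; rewrite subnK//.
  have : inf N <= `|x m| by apply: ge_inf => //; exists m.
  lra.
pose w := lim (x @ \oo).
have xw : x @ \oo --> w by exact: cauchy_cvg.
have far n e : 0 < e -> exists k, `|x (k + n)%N - w| < e.
  move=> e0; have /cvgrPdist_lt/(_ e e0)[m _ mP] := xw.
  by exists m; rewrite distrC; apply: mP; rewrite /= leq_addr.
have Dw : D w.
  by apply: (closed_cvg _ clD) xw; exact: nearW.
have Sw n : S (x n) w.
  split=> //; apply/ler_addgt0Pr => e e0; have e20 : 0 < e / 2 by lra.
  have [k] := far n _ e20; have := (Sx n k).2; rewrite [`|x _ - w|]distrC.
  have := ler_distD (x (k + n)%N) w (x n).
  have := ler_normD (w - x (k + n)%N) (x (k + n)%N); rewrite subrK; lra.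
(* A violating [c] lies in every [S (x k)], so [|x (k+1)| <= (|x k| + |c|) / 2]; in the limit
   [|w| <= |c|]. *)
exists w => // c Dc; rewrite leNgt; apply/negP => cw.
suff : `|w| <= `|c| by have := normr_ge0 (c - w); lra.
apply/ler_addgt0Pr => e e0; have [k] := far 0%N e e0; rewrite addn0 => xkw.
have Sc : S (x k) c.
  split=> //; have := (Sw k).2; have := ler_distD w c (x k); lra.
have := (nextP _ (Dx k)).2 _ Sc; have := (Sw k.+1).2.
rewrite -[x k.+1]/(next (x k)); have := normr_ge0 (w - next (x k)).
by have := ler_normD (x k - w) w; rewrite subrK; lra.
Qed.

(** The homothety of centre [y] and ratio [d] maps the ball around [v] into [C]. *)
Lemma convex_set_ball {R : realType} {X : normedModType R} (C : set X) y v
    (r d : R) : convex_set C -> C y -> (forall x, `|x - v| < r -> C x) ->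
  0 < d -> d <= 1 -> forall x, `|x - ((1 - d) *: y + d *: v)| < d * r -> C x.
Proof.
move=> /convex_setP cC Cy vC d0 d1 x xr.
have -> : x = (1 - d) *: y + d *: (d^-1 *: (x - (1 - d) *: y)).
  by rewrite scalerA divff ?gt_eqF// scale1r addrC subrK.
apply: cC => //; [by rewrite subr_ge0|exact: ltW|by rewrite subrK|apply: vC].
rewrite -[v](scalerK (lt0r_neq0 d0)) -scalerBr -addrA -opprD normrZ normfV.
by rewrite gtr0_norm// mulrC ltr_pdivrMr// mulrC.
Qed.

(** * Extension at the origin for each kind of domain *)

Section regularity.
Context {R : realType} {X : completeNormedModType R}.
Variables (T : X -> set (dual X)) (K : R).
Hypotheses (mT : maximal_monotone T) (K0 : 0 <= K).
Hypothesis TK : forall y g, T y g -> - (K * `|y|) <= g y.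

Local Notation hull := (convex_hull (lifted_graph T)).
Local Notation hull_dom := (convex_hull (domain T)).

Lemma closed_convex_extension : closed (domain T) -> convex_set (domain T) ->
  exists2 z : dual X, T 0 z & forall u, `|z u| <= K * `|u|.
Proof.
move=> clD cvD; have cD := (convex_setP (domain T)).1 cvD.
have D0 : domain T !=set0.
  apply: contrapT => nD.
  have T0 y g : T y g -> False by move=> Tyg; apply: nD; exists y, g.
  by apply: (T0 0 0); apply/(maximal_monotoneP T).1 => // y g /T0.
have [T0|nT0] := pselect (domain T 0).
  apply: (starshaped_extension mT K0 TK T0) => y d s hy d0 d1 s0 s1.
  rewrite scaler0 addr0 scalerA -[_ *: y]addr0 -(scaler0 _ (1 - s * (1 - d))).
  apply: cD => //; first by rewrite mulr_ge0; lra.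
  - by nra.
  - by rewrite addrC subrK.
  - exact: convex_hull_min hy.
have [w Dw wD] := norm_almost_minimal clD D0.
have w0 : 0 < `|w|.
  by rewrite normr_gt0; apply: contra_notN nT0 => /eqP <-.
exfalso; apply: (no_outward_normal mT (eta := `|w| / 3) TK Dw cvD) => //.
  by lra.
(* The constant 3 comes from [|w| <= |e| + |e - w| / 2] and [|e - w| <= |e| + |w|]. The former is
   the Ekeland inequality at [e] if [u <= 1], and follows from the one at [c] if [u > 1]. *)
move=> u c u0 Dc; set e := w + _.
have ew : `|e - w| <= `|e| + `|w| by exact: ler_normB.
have [u1|u1] := leP u 1.
  suff /wD : domain T e by lra.
  have -> : e = (1 - u) *: w + u *: c.
    by rewrite /e scalerBr scalerBl scale1r addrCA addrC.
  by apply: cD => //; lra.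
have up : 0 < u by lra.
have cE : u *: c = (u - 1) *: w + e.
  by rewrite /e scalerBr scalerBl scale1r addrA subrK addrCA subrr addr0.
have := wD _ Dc; rewrite -(ler_pM2l up) mulrDr mulrCA.
have -> : u * `|c| = `|u *: c| by rewrite normrZ gtr0_norm.
have -> : u * `|c - w| = `|e - w|.
  by rewrite /e addrAC subrr add0r normrZ gtr0_norm.
have : `|u *: c| <= (u - 1) * `|w| + `|e|.
  by rewrite cE (le_trans (ler_normD _ _))// normrZ gtr0_norm// subr_gt0.
lra.
Qed.

Lemma interior_extension v (r : R) : 0 < r ->
    (forall y, `|y - v| < r -> domain T y) ->
  exists2 z : dual X, T 0 z & forall u, `|z u| <= K * `|u|.
Proof.
move=> r0 vr.
have hull_vr y : `|y - v| < r -> hull_dom y.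
  by move=> /vr; exact: convex_hull_sub.
have cH : convex_set hull_dom by exact: convex_hull_convex.
have Dv : domain T v by apply: vr; rewrite subrr normr0.
pose S := [set s | 0 <= s /\ hull_dom (s *: v)].
have S1 : S 1 by split => //; rewrite scale1r; exact: convex_hull_sub.
have lbS : has_lbound S by exists 0 => s [].
have hS : has_inf S by split=> //; exists 1.
pose s0 := inf S.
have s0_ge0 : 0 <= s0 by apply: lb_le_inf => [|s []//]; exists 1.
(* [s v] lies between some [m v] in the hull, [m < s], and [v], which is interior to the hull. *)
have ray s : s0 < s -> s < 1 ->
    exists2 e, 0 < e & forall y, `|y - s *: v| < e -> hull_dom y.
  move=> s0s s1; have ss0 : 0 < s - s0 by rewrite subr_gt0.
  have [m [m0 Sm]] := inf_adherent ss0 hS; rewrite -/s0 addrC subrK => ms.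
  have m1 : 0 < 1 - m by lra.
  pose d := (s - m) / (1 - m).
  have d0 : 0 < d by rewrite divr_gt0//; lra.
  have d1 : d <= 1 by rewrite ler_pdivrMr//; lra.
  exists (d * r); first exact: mulr_gt0.
  move=> y yd; apply: (convex_set_ball cH Sm hull_vr d0 d1).
  rewrite scalerA -scalerDl (_ : _ + d = s)//.
  have : d * (1 - m) = s - m by rewrite divfK// gt_eqF.
  by lra.
have [s00|s00] := eqVneq s0 0.
  apply: (starshaped_extension mT K0 TK Dv) => y d s hy d0 d1 t0 t1.
  (* Then [s ((1 - d) y + d v) = (1 - q) y + q ((s d / q) v)], and [ray] makes [(s d / q) v]
     interior to the hull. *)
  pose q := 1 - s * (1 - d).
  have sd : s * (1 - d) < 1 by nra.
  have sd0 : 0 <= s * (1 - d) by rewrite mulr_ge0; lra.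
  have q0 : 0 < q by rewrite /q; lra.
  have p0 : s0 < s * d / q by rewrite s00 divr_gt0// mulr_gt0.
  have p1 : s * d / q < 1 by rewrite ltr_pdivrMr// /q; lra.
  have [e e0 eP] := ray _ p0 p1.
  apply: (interior_hull_domain mT (mulr_gt0 q0 e0)) => x xe.
  apply: (convex_set_ball cH hy eP q0); first by rewrite /q; lra.
  have -> : 1 - q = s * (1 - d) by rewrite /q; lra.
  by rewrite scalerA [q * _]mulrC divfK ?gt_eqF// -!scalerA -scalerDr.
have {}s00 : 0 < s0 by rewrite lt_neqAle eq_sym s00.
have s01 : s0 < 1.
  have v0 := normr_ge0 v.
  pose e := r / (2 * (`|v| + r)).
  have e0 : 0 < e by rewrite divr_gt0//; lra.
  have e1 : e < 1 by rewrite ltr_pdivrMr; lra.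
  apply: (@le_lt_trans _ _ (1 - e)); last by lra.
  apply: ge_inf => //; split; first by lra.
  apply: hull_vr; rewrite scalerBl scale1r addrAC subrr add0r normrN normrZ.
  by rewrite gtr0_norm// mulrAC ltr_pdivrMr; nra.
have rayD s : s0 < s -> s < 1 -> domain T (s *: v).
  by move=> h h'; have [e e0] := ray s h h'; exact: interior_hull_domain.
(* Monotonicity against a point over [v + e u], with [h v >= - K |v|] from [TK], bounds [h u] for
   [h] in [F]. *)
pose F := [set g | exists s, [/\ s0 < s, s < 1 & T (s *: v) g]].
have [u|L L0 FL] := dual_uniform_bounded (F := F).
  have u0 := normr_ge0 u.
  pose e := r / (2 * (`|u| + 1)).
  have e0 : 0 < e by rewrite divr_gt0//; lra.
  have [|g Tg] := vr (v + e *: u).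
    rewrite addrAC subrr add0r normrZ gtr0_norm//.
    by rewrite mulrAC ltr_pdivrMr; nra.
  exists ((`|g v| + e * g u + K * `|v|) / e) => h [s [s0s s1 Th]].
  have sp : 0 < s by lra.
  rewrite ler_pdivlMr//.
  have := mT.1 (v + e *: u, g) (s *: v, h) Tg Th.
  rewrite /= dual_subE !dualB !dualD !dualZ.
  have := TK Th; rewrite dualZ normrZ gtr0_norm// mulrCA -mulrN ler_pM2l// => hv.
  have s1' : 0 <= 1 - s by lra.
  have := ler_wpM2l s1' hv; have := ler_wpM2l s1' (ler_norm (g v)).
  have := normr_ge0 (g v); have := mulr_ge0 K0 (normr_ge0 v).
  by nra.
have Dw : domain T (s0 *: v).
  have [c hc|z Tz _] := maximal_hull_extension (x := s0 *: v) mT L0; last by exists z.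
  rewrite dualZ.
  (* The bound [L], uniform on [F], allows [s] to decrease to [s0]. *)
  apply: (@affine_ge0 _ _ ((1 - s0) * (`|c.1.2 v| + L * `|v|))) => d d0 d1.
  pose s := s0 + d * (1 - s0).
  have ss0 : s0 < s by rewrite ltrDl mulr_gt0// subr_gt0.
  have s1 : s < 1 by rewrite /s; nra.
  have [g Tg] := rayD s ss0 s1.
  have gL := FL g; have {}gL := gL (ex_intro _ s (And3 ss0 s1 Tg)).
  have := hull_monotone mT.1 hc Tg; rewrite !dualZ.
  have := gL (c.1.1 - s *: v); rewrite ler_norml dualB dualZ => /andP[h1 _].
  have : L * `|c.1.1 - s *: v| <= L * (`|c.1.1 - s0 *: v| + d * (1 - s0) * `|v|).
    apply: ler_wpM2l => //; apply: (le_trans (ler_distD (s0 *: v) _ _)).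
    rewrite lerD2l -scalerBl normrZ /s opprD addrA subrr add0r normrN ger0_norm//.
    by rewrite mulr_ge0//; lra.
  have d10 : 0 <= d * (1 - s0) by rewrite mulr_ge0//; lra.
  have h3 : - c.1.2 v <= `|c.1.2 v| by rewrite lerNl lerNnormlW.
  have := ler_wpM2l d10 h3; rewrite /s in h1 *; lra.
exfalso; apply: (no_outward_normal mT (eta := s0 * r) TK Dw cH).
- by move=> y; exact: convex_hull_sub.
- exact: mulr_gt0.
(* If [|e| < s0 r], then [v - e / s0] is in the hull; combined with [c] it puts
   [(u s0 / (s0 + u)) v] there, against the minimality of [s0]. *)
move=> u c u0 hc; rewrite leNgt; apply/negP; set e := _ + _ => er.
have su : 0 < s0 + u by lra.
have hq : hull_dom (v - s0^-1 *: e).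
  apply: hull_vr; rewrite addrAC subrr add0r normrN normrZ normfV gtr0_norm//.
  by rewrite mulrC ltr_pdivrMr// mulrC.
suff : S (u * s0 / (s0 + u)).
  move=> /(ge_inf lbS); rewrite -/s0 ler_pdivlMr//; nra.
split; first by rewrite divr_ge0 ?mulr_ge0// ltW.
have -> : (u * s0 / (s0 + u)) *: v =
    (s0 / (s0 + u)) *: (v - s0^-1 *: e) + (u / (s0 + u)) *: c.
  apply: (scalerI (lt0r_neq0 su)).
  rewrite scalerDr !scalerA ![(s0 + u) * _]mulrC !divfK ?gt_eqF//.
  rewrite scalerBr scalerA divff ?gt_eqF// scale1r /e scalerBr scalerA.
  by rewrite opprD addrA subrr add0r opprB subrK.
move/convex_setP: cH; apply => //; rewrite ?divr_ge0// ?ltW//.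
by rewrite -mulrDl divff// gt_eqF.
Qed.

End regularity.

(** * Translation to the origin; the gap is at most the distance *)

Section translation.
Context {R : realType} {X : normedModType R}.
Implicit Types (T : X -> set (dual X)) (f g z : dual X) (x y : X).

Definition translate T x f y : set (dual X) := [set g | T (x + y) (f + g)].

Lemma translate_maximal_monotone T x f :
  maximal_monotone T -> maximal_monotone (translate T x f).
Proof.
move=> mT; apply/maximal_monotoneP => y z; rewrite /translate /=.
have [H1 H2] := (maximal_monotoneP T).1 mT (x + y) (f + z).
split=> [/H1 h y' g' /h|h].
  by rewrite !opprD [in X in X -> _]addrACA subrr add0r addrACA subrr add0r.
apply: H2 => y' g' Tyg; have := h (y' - x) (g' - f).
rewrite !subrKC => /(_ Tyg).
by rewrite !opprD !addrA.
Qed.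

Lemma domain_translate T x f y : domain (translate T x f) y <-> domain T (x + y).
Proof.
split=> [[g Tg]|[g Tg]]; first by exists (f + g).
by exists (g - f); rewrite /translate /= subrKC.
Qed.

Lemma dual_norm_ge0 f : (0 <= dual_norm f)%E.
Proof.
apply: ereal_sup_ubound; exists 0; first by rewrite /= normr0.
by rewrite dual0 normr0.
Qed.

Lemma dual_norm_le f (K : R) : 0 <= K -> (forall x, `|f x| <= K * `|x|) ->
  (dual_norm f <= K%:E)%E.
Proof.
move=> K0 fK; apply: ge_ereal_sup => _ [x x1 <-].
by rewrite lee_fin (le_trans (fK x))// -[leRHS]mulr1 ler_wpM2l.
Qed.

(** Monotonicity gives [(f - h) (y - x) <= (f - g) (y - x)]; it remains to test [g - f] on the unit
    vector along [y - x]. *)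
Lemma gapL_le_dual_dist T x f :
  monotone_multi T -> (gapL x f T <= dual_dist f (T x))%E.
Proof.
move=> mT; apply: le_ereal_inf_tmp => _ [g Tg <-].
rewrite ge_max dual_norm_ge0 /=; apply: ge_ereal_sup => _ [[y h] [Th /= yx] <-].
have d0 : 0 < `|x - y| by rewrite normr_gt0 subr_eq0 eq_sym.
apply: (@le_trans _ _ (`|(g - f) (`|x - y|^-1 *: (y - x))|)%:E).
  rewrite lee_fin dualZ normrM gtr0_norm ?invr_gt0// mulrC ler_pM2l ?invr_gt0//.
  have := mT (y, h) (x, g) Th Tg; rewrite /= dual_subE => h1.
  rewrite -normrN (le_trans _ (ler_norm _))// !dual_subE; lra.
apply: ereal_sup_ubound; exists (`|x - y|^-1 *: (y - x)) => //=.
by rewrite normrZ normfV normr_id (distrC y) mulVf ?gt_eqF//.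
Qed.

End translation.

(** * Equality of the gap and the distance *)

Theorem corollary3 (R : realType) (X : completeNormedModType R)
    (T : X -> set (dual X)) :
  maximal_monotone T ->
  (closed (domain T) /\ convex_set (domain T)) \/
    (domain T)° !=set0 ->
  regular T.
Proof.
move=> mT DT; split=> // x f; apply/le_anti.
rewrite (gapL_le_dual_dist x f mT.1) /=.
have gap0 : (0 <= gapL x f T)%E by rewrite le_max lexx.
case gapE : (gapL x f T) gap0 => [K| |] // K0; last by rewrite leey.
rewrite lee_fin in K0.
(* The quotients in the gap are the [- g y / |y|] of the translated graph. *)
have TK y g : translate T x f y g -> - (K * `|y|) <= g y.
  rewrite /translate /= => Tg; have [->|y0] := eqVneq y 0.
    by rewrite dual0 normr0 mulr0 oppr0.
  have : ((- g y / `|y|)%:E <= gapL x f T)%E.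
    rewrite le_max; apply/orP; right; apply: ereal_sup_ubound.
    exists (x + y, f + g) => /=.
      by split=> //; rewrite -subr_eq0 addrAC subrr add0r.
    by rewrite !opprD !addrA !subrr !sub0r normrN addrAC subrr add0r.
  by rewrite gapE lee_fin ler_pdivrMr ?normr_gt0// lerNl.
have mS := translate_maximal_monotone x f mT.
have [z Tz zK] : exists2 z, translate T x f 0 z & forall u, `|z u| <= K * `|u|.
  case: DT => [[clT cvT]|[v]].
    apply: closed_convex_extension => //.
      rewrite (_ : domain _ = (fun y => x + y) @^-1` domain T); last first.
        by apply/seteqP; split=> y; case: (domain_translate T x f y).
      apply: closed_comp => // y _.
      by apply: continuousD => //; exact: cst_continuous.
    apply/convex_setP => s t y y' s0 t0 st /domain_translate h /domain_translate h'.
    apply/domain_translate.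
    rewrite (_ : x + _ = s *: (x + y) + t *: (x + y')).
      exact: ((convex_setP (domain T)).1 cvT).
    by rewrite !scalerDr addrACA -scalerDl st scale1r.
  rewrite /interior /= => /nbhs_ballP[r /= r0]; rewrite -ball_normE => vr.
  apply: (interior_extension mS K0 TK r0 (v := v - x)) => y yr.
  apply/domain_translate; apply: vr => /=.
  by rewrite distrC; move: yr; rewrite opprB addrCA addrA.
apply: (le_trans _ (dual_norm_le K0 zK)); apply: ereal_inf_lbound.
exists (f + z); first by move: Tz; rewrite /translate /= addr0.
by rewrite addrAC subrr add0r.
Qed.
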